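(* Let $p$ be a prime number such that $p \equiv 1 \pmod 4$. Then: (i) if $p = 5$ or $p \equiv 1 \pmod 3$, then $\kappa(9p) \equiv 2 \pmod 4$; (ii) if $p \equiv 2 \pmod 3$ and $p \neq 5$, then $\kappa(9p) \equiv 0 \pmod 4$.
   Context: A real quadratic number is a real irrational root $w$ of a quadratic polynomial with integer coefficients; $w'$ denotes its algebraic conjugate over $\mathbb{Q}$. The discriminant $\mathrm{disc}(w)$ of $w$ is $b^2-4ac$, where $aw^2+bw+c=0$ with $a,b,c\in\mathbb{Z}$, $a>0$, $\gcd(a,b,c)=1$. A real quadratic number $w$ is reduced if $w>1$ and $-1<w'<0$. For a positive non-square integer $D$, $\kappa(D)$ denotes the (finite) number of reduced real quadratic numbers $w$ with $\mathrm{disc}(w)=D$. *)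

(* Defs.v *)
From mathcomp Require Import all_boot all_order all_algebra finmap.
From mathcomp Require Import boolp classical_sets cardinality reals.
From mathcomp Require Import zify ring lra.

Set Implicit Arguments.
Unset Strict Implicit.
Unset Printing Implicit Defensive.

Import Order.TTheory GRing.Theory Num.Theory.

Local Open Scope classical_set_scope.
Local Open Scope ring_scope.

Definition real_quadratic (R : realType) (w : R) : Prop :=
  irrational w /\
  exists2 f : {poly int}, size f = 3 & root (map_poly intr f) w.

(* A conjugate other than [w] itself; exactly one exists in [R] when [w]
   is a real quadratic number. *)
Definition conjugate (R : realType) (w w' : R) : Prop :=
  w' != w /\
  exists f : {poly rat}, [/\ irreducible_poly f,
    root (map_poly ratr f) w & root (map_poly ratr f) w'].

(* "disc(w) = D", as a relation: the conditions on [a], [b], [c] determine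
   them when [w] is a quadratic number. *)
Definition has_disc (R : realType) (w : R) (D : int) : Prop :=
  exists a b c : int,
    [/\ 0 < a, gcdz (gcdz a b) c = 1,
        a%:~R * w ^+ 2 + b%:~R * w + c%:~R = 0 &
        D = b ^+ 2 - 4 * a * c].

Definition reduced (R : realType) (w : R) : Prop :=
  [/\ real_quadratic w, 1 < w &
      exists2 w' : R, conjugate w w' & -1 < w' < 0].

Definition reduced_of_disc (R : realType) (D : nat) : set R :=
  [set w | reduced w /\ has_disc w D%:Z].
Arguments reduced_of_disc R D : clear implicits.

(* [fset_set] is the empty set on infinite sets, hence the next lemma. *)
Definition kappa (R : realType) (D : nat) : nat :=
  #|` fset_set (reduced_of_disc R D)|%fset.

Lemma finite_reduced_of_disc (R : realType) (D : nat) :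
  finite_set (reduced_of_disc R D).
Proof.
pose f (ij : 'I_D.+1 * 'I_(D + D).+1) : R :=
  (- (ij.2%:R - D%:R) + Num.sqrt D%:R) / (2 * ij.1%:R).
apply: (@sub_finite_set _ _ (f @` setT)); last first.
  exact/finite_image/finite_finset.
move=> w [[_ w_gt1 [w' [w'w [p [[_ irrp] pw pw']]] /andP[_ w'_lt0]]]].
move=> [a [b [c [a_gt0 _ eqw eqD]]]].
pose q : {poly rat} := a%:~R *: 'X^2 + b%:~R *: 'X + c%:~R%:P.
have qE x : (map_poly (ratr : rat -> R) q).[x] =
    a%:~R * x ^+ 2 + b%:~R * x + c%:~R.
  by rewrite !rmorphD /= !map_polyZ /= map_polyXn map_polyX map_polyC /=
    !hornerE !ratr_int.
have pq : p %| q.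
  have := irrp (gcdp p q); case: eqVneq => [pq1 _|_ /(_ isT (dvdp_gcdl _ _)) pq].
    have cpq : coprimep (map_poly (ratr : rat -> R) p) (map_poly ratr q).
      by rewrite coprimep_map /coprimep pq1.
    by have := coprimep_root cpq pw; rewrite qE eqw eqxx.
  by rewrite -(eqp_dvdl _ pq) dvdp_gcdr.
have eqw' : a%:~R * w' ^+ 2 + b%:~R * w' + c%:~R = 0.
  have : map_poly (ratr : rat -> R) p %| map_poly ratr q by rewrite dvdp_map.
  by case/dvdpP=> k defq; rewrite -qE defq hornerM (rootP pw') mulr0.
have aR_gt0 : 0 < a%:~R :> R by rewrite ltr0z.
have sumww' : b%:~R = - a%:~R * (w + w').
  have ww'0 : w' - w != 0 by rewrite subr_eq0.
  by apply: (mulIf ww'0); nra.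
have prodww' : c%:~R = a%:~R * (w * w') by move: eqw; rewrite sumww'; nra.
have c_lt0 : c < 0.
  rewrite -(@ltrz0 R) prodww' pmulr_rlt0 // pmulr_rlt0 //.
  exact: lt_trans w_gt1.
have aD : (`|a|%N < D.+1)%N by nia.
have bD : (`|(b + D%:Z)%R|%N < (D + D).+1)%N by nia.
exists (Ordinal aD, Ordinal bD) => //; rewrite /f /=.
have -> : `|a|%N%:R = a%:~R :> R by rewrite -[in RHS](gtz0_abs a_gt0).
have -> : `|(b + D%:Z)%R|%N%:R = b%:~R + D%:R :> R.
  have h : 0 <= b + D%:Z by nia.
  rewrite -[LHS]/((`|(b + D%:Z)%R|%N : int)%:~R) gez0_abs //.
  by rewrite intrD.
have -> : D%:R = (a%:~R * (w - w')) ^+ 2 :> R.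
  rewrite -[LHS]/((D : int)%:~R) eqD.
  by rewrite expr2 intrB !intrM sumww' prodww'; ring.
rewrite sqrtr_sqr ger0_norm; last by rewrite mulr_ge0 ?subr_ge0 ?ltW //; lra.
by rewrite sumww'; field; rewrite gt_eqF.
Qed.

(* Main.v *)
Require Import Defs.
From mathcomp Require Import all_boot all_order all_algebra reals.
From mathcomp Require Import finmap classical_sets cardinality.
From mathcomp Require Import zify ring lra.

(** A reduced number of discriminant D is the larger root of a unique primitive
form (a, b, c), meaning [a w^2 - b w - c] with [b^2 + 4 a c = D], [a, c > 0]
and [|a - c| < b].  On the reduced forms of discriminant 9 p, with p = 1 mod 4,
exchanging a and c exchanges the two genera, which are told apart by the values
mod 3; hence [kappa (9 p)] is twice the number of reduced forms in one genus.
For fixed a the admissible b lie in the interval [(sqrt D - 2 a, sqrt D)] of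
length 2 a, shortened to [(2 a - sqrt D, sqrt D)], which is symmetric about a,
when [2 a > sqrt D]; so replacing b by the admissible b' = - b mod 2 a is an
involution, and it preserves the genus.  Its fixed points have a | b, hence
a | 9 p and a^2 < 9 p, so a = 1, a = 9 (if p > 5), or a = 5 = p.  In the genus
of the values 1 mod 3, the form with a = 1 always lies, the one with a = 5
never, and the one with a = 9 exactly when p = 2 mod 3. *)

Set Implicit Arguments.
Unset Strict Implicit.
Unset Printing Implicit Defensive.

Import Order.TTheory GRing.Theory Num.Theory.

Local Open Scope ring_scope.

(** * Counting with involutions *)

(** Points that are not fixed come in pairs [{y, f y}]; removing one pair keeps both the parity and
    the fixed points. *)
Lemma odd_card_involution (T : choiceType) (f : T -> T) (A : {fset T}) :
  {in A, forall x, f x \in A} -> {in A, cancel f f} ->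
  odd #|` A| = odd #|` [fset x in A | f x == x]%fset|.
Proof.
have [n] := ubnP #|` A|; elim: n A => // n IHn A leAn fA fK.
have [x /= fx_neq|fix_all] := pickP [pred x : A | f (val x) != val x];
  last first.
  suff -> : [fset x in A | f x == x]%fset = A by [].
  apply/fsetP => x; rewrite !inE /=; case: (boolP (x \in A)) => //= xA.
  by have /= /negbFE := fix_all [` xA]%fset.
set y := val x in fx_neq.
have yA : y \in A by apply: valP.
have fyA := fA _ yA.
pose B := (A `\ y `\ f y)%fset.
have fyAy : f y \in (A `\ y)%fset by rewrite !inE fx_neq.
have cardA : #|` A| = #|` B|.+2.
  by rewrite (cardfsD1 y) yA (cardfsD1 (f y) (A `\ y)%fset) fyAy.
have -> : [fset x in A | f x == x]%fset = [fset x in B | f x == x]%fset.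
  apply/fsetP => z; rewrite !inE /=.
  have [->|] := eqVneq z (f y); first by rewrite fK // eq_sym (negPf fx_neq) andbF.
  by have [->|] := eqVneq z y; rewrite ?(negPf fx_neq) ?andbF.
rewrite cardA /= negbK; apply: IHn; first by rewrite cardA in leAn; lia.
  move=> z; rewrite !inE => /and3P[z_neq zy zA]; rewrite fA // andbT.
  apply/andP; split.
    by apply: contra zy => /eqP/(congr1 f); rewrite !fK // => ->.
  by apply: contra z_neq => /eqP <-; rewrite fK.
by move=> z; rewrite !inE => /and3P[_ _ zA]; apply: fK.
Qed.

Lemma card_involution_halves (T : choiceType) (f : T -> T) (P : pred T)
    (A : {fset T}) :
  involutive f -> {in A, forall x, f x \in A} ->
  {in A, forall x, P (f x) = ~~ P x} ->
  #|` A| = (2 * #|` [fset x in A | P x]%fset|)%N.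
Proof.
move=> fK fA Pf; set B := [fset x in A | P x]%fset.
rewrite -(cardfsID B A) mul2n -addnn; congr (_ + _)%N.
  by congr #|` _|; apply/fsetP => x; rewrite !inE; case: (x \in A).
have -> : (A `\` B = f @` B)%fset; last by rewrite card_imfset //; apply: inv_inj.
apply/fsetP => x; rewrite !inE /=; apply/andP/imfsetP => /= [[nB xA]|[y]].
  exists (f x); last by rewrite fK.
  by rewrite !inE /= fA // Pf //; move: nB; rewrite xA.
by rewrite !inE /= => /andP[yA Py] ->; rewrite fA // Pf // Py.
Qed.

(** * Integer square roots, divisibility and non-squares *)

Lemma isqrt_exists (n : nat) : exists r : nat, (r ^ 2 <= n < r.+1 ^ 2)%N.
Proof.
elim: n => [|n [r hr]]; first by exists 0.
have [h|h] := leqP (r.+1 ^ 2) n.+1; [exists r.+1 | exists r]; nia.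
Qed.

Lemma gcdz3_eq1P (a b c : int) :
  reflect (forall d : int, (d %| a)%Z -> (d %| b)%Z -> (d %| c)%Z -> (d %| 1)%Z)
          (gcdz (gcdz a b) c == 1).
Proof.
apply: (iffP eqP) => [g1 d da db dc|h].
  by have := dvdz_gcd d (gcdz a b) c; rewrite g1 dvdz_gcd da db dc.
set g := gcdz _ _.
have gE : g = `|g|%N by rewrite /g /gcdz.
have : (g %| 1)%Z.
  apply: h; rewrite /g.
  - by apply: dvdz_trans (dvdz_gcdl _ _) (dvdz_gcdl _ _).
  - by apply: dvdz_trans (dvdz_gcdl _ _) (dvdz_gcdr _ _).
  - exact: dvdz_gcdr.
by rewrite gE dvdz1 => /eqP ->.
Qed.

Lemma divz_bounds (d m q : int) : 0 < d -> d * q <= m < d * q + d -> (m %/ d)%Z = q.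
Proof.
move=> d0 mq; have -> : m = q * d + (m - d * q) by ring.
by rewrite divzMDl ?gt_eqF // divz_small ?addr0 //; lia.
Qed.

(** If [x] were nonzero, the [p]-adic valuation would be odd on the left and even on the right. *)
Lemma nonsquare_mul_prime (p : nat) (z x : int) : prime p ->
  p%:Z * x ^+ 2 = z ^+ 2 -> x = 0.
Proof.
move=> pp eqz; apply/eqP/negPn/negP => x0.
have z0 : z != 0.
  apply: contra x0 => /eqP z0; move: eqz; rewrite z0 expr0n /= => /eqP.
  by rewrite mulf_eq0 sqrf_eq0 => /orP[|//]; have := prime_gt0 pp; lia.
have /(congr1 (logn p)) : (p * `|x| ^ 2 = `|z| ^ 2)%N.
  by rewrite -!abszX -[in RHS]eqz abszM.
rewrite lognM ?(prime_gt0 pp) ?expn_gt0 ?absz_gt0 ?x0 // !lognX logn_prime // eqxx.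
lia.
Qed.

(** * Reduced numbers as larger roots of reduced forms *)

Lemma horner_map_quadratic (S R : nzRingType) (f : {rmorphism S -> R}) (a b c : S)
    (x : R) :
  a != 0 -> size (Poly [:: c; b; a]) = 3 /\
  (map_poly f (Poly [:: c; b; a])).[x] = f a * x ^+ 2 + f b * x + f c.
Proof.
move=> a0; have polyE : polyseq (Poly [:: c; b; a]) = [:: c; b; a] by exact: (@PolyK _ c).
split; first by rewrite polyE.
by rewrite map_polyE polyE horner_Poly /= mul0r add0r mulrDl expr2 mulrA.
Qed.

(* The form (a, b, c) stands for the polynomial [a w^2 - b w - c]; the signs
   make all three entries of a reduced form positive. *)
Definition reduced_form (D : int) (x : int * int * int) : bool :=
  let: (a, b, c) := x in
  [&& 0 < a, 0 < c, a < b + c, c < b + a, b ^+ 2 + 4 * a * c == D &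
      gcdz (gcdz a b) c == 1].

Definition form_root (R : realType) (D : nat) (x : int * int * int) : R :=
  (x.1.2%:~R + Num.sqrt D%:R) / (2 * x.1.1%:~R).

Lemma rat_sqr_neq (D : nat) (y : rat) :
  (forall z x : int, D%:Z * x ^+ 2 = z ^+ 2 -> x = 0) -> y ^+ 2 != D%:R.
Proof.
move=> Dsq; apply/eqP => yD.
have /eqP := denq_neq0 y; apply; apply: (Dsq (numq y)).
apply: (@intr_inj rat); rewrite !expr2 !intrM -[D%:~R]/(D%:R) -yD numqE.
by ring.
Qed.

(** Equal roots give [s * (a - a') = a' * b - a * b'] with [s] the square root of [D]; squaring
    forces [a = a'], since [D] is not a rational square. *)
Lemma form_root_inj (R : realType) (D : nat) :
  (forall z x : int, D%:Z * x ^+ 2 = z ^+ 2 -> x = 0) ->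
  {in reduced_form D &, injective (form_root R D)}.
Proof.
move=> Dsq [[a b] c] [[a' b'] c'] /and5P[a0 _ _ _ /andP[/eqP eqD _]].
move=> /and5P[a0' _ _ _ /andP[/eqP eqD' _]]; rewrite /form_root /= => eqw.
set s : R := Num.sqrt D%:R in eqw.
have s2 : s ^+ 2 = D%:R by apply: sqr_sqrtr.
have aR : a%:~R != 0 :> R by rewrite intr_eq0 gt_eqF.
have aR' : a'%:~R != 0 :> R by rewrite intr_eq0 gt_eqF.
have eqs : s * (a - a')%:~R = (a' * b - a * b')%:~R.
  rewrite !intrB !intrM.
  have := congr1 ( *%R (2 * a%:~R * a'%:~R)) eqw.
  have -> : 2 * a%:~R * a'%:~R * ((b%:~R + s) / (2 * a%:~R)) =
    a'%:~R * (b%:~R + s) by field.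
  have -> : 2 * a%:~R * a'%:~R * ((b'%:~R + s) / (2 * a'%:~R)) =
    a%:~R * (b'%:~R + s) by field.
  by move=> h; lra.
have aa' : a - a' = 0.
  apply: (Dsq (a' * b - a * b')); apply: (@intr_inj R).
  by rewrite !expr2 !intrM -eqs -[D%:~R]/(D%:R) -s2; ring.
have {}aa' : a' = a by lia.
have bb' : b' = b.
  move: eqs; rewrite aa' subrr mulr0 -mulrBr => /esym/eqP.
  by rewrite intr_eq0 mulf_eq0 subr_eq0 gt_eqF //= => /eqP.
subst a' b'; congr (_, _, _).
have : 4 * a * (c - c') = 0 by lia.
by move/eqP; rewrite !mulf_eq0 (gt_eqF a0) subr_eq0 => /orP[//|/eqP].
Qed.

Lemma form_root_reduced (R : realType) (D : nat) (x : int * int * int) :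
  (forall z x : int, D%:Z * x ^+ 2 = z ^+ 2 -> x = 0) ->
  reduced_form D x -> reduced_of_disc R D (form_root R D x).
Proof.
case: x => [[a b] c] Dsq /and5P[a0 c0 ab cb /andP[/eqP eqD /eqP cop]].
set w := form_root R D _.
pose s : R := Num.sqrt D%:R.
have s2 : s ^+ 2 = D%:R by apply: sqr_sqrtr.
have s0 : 0 <= s by apply: sqrtr_ge0.
have aR : 0 < a%:~R :> R by rewrite ltr0z.
have cR : 0 < c%:~R :> R by rewrite ltr0z.
have abR : a%:~R < b%:~R + c%:~R :> R by rewrite -intrD ltr_int.
have cbR : c%:~R < b%:~R + a%:~R :> R by rewrite -intrD ltr_int.
have eqDR : b%:~R ^+ 2 + 4 * a%:~R * c%:~R = s ^+ 2 :> R.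
  by rewrite s2 -[D%:R]/(D%:~R) -eqD !expr2 intrD !intrM.
pose w' := (b%:~R - s) / (2 * a%:~R).
have a2R : 2 * a%:~R != 0 :> R by rewrite mulf_neq0 ?gt_eqF.
have wE : 2 * a%:~R * w = b%:~R + s by rewrite /w /form_root /= mulrC mulfVK.
have w'E : 2 * a%:~R * w' = b%:~R - s by rewrite /w' mulrC mulfVK.
have sgt : 0 < s by rewrite lt_neqAle s0 andbT; apply/eqP; nra.
have a2R_gt0 : 0 < 2 * a%:~R :> R by rewrite mulr_gt0.
have bR : 0 < b%:~R :> R by lra.
have ac0 : 0 < a%:~R * c%:~R :> R by rewrite mulr_gt0.
(* The next three bounds on [s] amount to [w' < 0], [-1 < w'] and [1 < w]. *)
have bs : b%:~R < s by rewrite -(ltr_pXn2r (n := 2)) ?nnegrE ?ltW // -eqDR; lra.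
have sb : s < b%:~R + 2 * a%:~R.
  rewrite -(ltr_pXn2r (n := 2)) ?nnegrE ?addr_ge0 ?ltW // -eqDR; nra.
have abs : 2 * a%:~R - b%:~R < s.
  have [h|h] := ltP (2 * a%:~R - b%:~R : R) 0; first exact: lt_le_trans s0.
  by rewrite -(ltr_pXn2r (n := 2)) ?nnegrE // -eqDR; nra.
have eqw : a%:~R * w ^+ 2 + (- b)%:~R * w + (- c)%:~R = 0.
  by rewrite !intrN; apply: (mulfI a2R); nra.
have eqw' : a%:~R * w' ^+ 2 + (- b)%:~R * w' + (- c)%:~R = 0.
  by rewrite !intrN; apply: (mulfI a2R); nra.
(* Completing the square, a rational root [y] would make [2 a y - b] a rational square root of
   [D]. *)
have norat (y : rat) : a%:~R * y ^+ 2 + (- b)%:~R * y + (- c)%:~R != 0.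
  apply: contra (rat_sqr_neq (2 * a%:~R * y - b%:~R) Dsq) => /eqP eqy.
  by rewrite -[D%:R]/(D%:~R) -eqD !expr2 intrD !intrM; move: eqy;
     rewrite !intrN => eqy; apply/eqP; nra.
have a_neq0 : a != 0 by rewrite gt_eqF.
have aQ_neq0 : a%:~R != 0 :> rat by rewrite intr_eq0.
split; last first.
  exists a, (- b), (- c); split => //; last by rewrite -eqD; ring.
  by rewrite gcdzN gcdzN.
split.
- split.
    case=> y _ yw; have /eqP := norat y; apply; apply: (fmorph_inj (ratr : rat -> R)).
    by rewrite expr2 !rmorphD /= !rmorphM /= !ratr_int yw rmorph0 -expr2.
  have [sz ev] := horner_map_quadratic (intr : {rmorphism int -> R}) (- b) (- c) w a_neq0.
  by exists (Poly [:: - c; - b; a]); rewrite // /root ev eqw.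
- by rewrite -(ltr_pM2l a2R_gt0) wE mulr1 -ltrBlDl.
exists w'; last first.
  by apply/andP; split; rewrite -(ltr_pM2l a2R_gt0) w'E; lra.
split; first by apply/eqP; nra.
have [sz ev] := horner_map_quadratic (ratr : {rmorphism rat -> R}) (- b)%:~R (- c)%:~R w aQ_neq0.
have [_ ev'] := horner_map_quadratic (ratr : {rmorphism rat -> R}) (- b)%:~R (- c)%:~R w' aQ_neq0.
exists (Poly [:: (- c)%:~R; (- b)%:~R; a%:~R]); split.
- apply: cubic_irreducible; first by rewrite sz.
  move=> y; have [_] := horner_map_quadratic idfun (- b)%:~R (- c)%:~R y aQ_neq0.
  by rewrite map_poly_id // /root => ->; apply: norat.
- by rewrite /root ev /= !ratr_int eqw.
- by rewrite /root ev' /= !ratr_int eqw'.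
Qed.

Lemma reduced_form_root (R : realType) (D : nat) (w : R) :
  reduced_of_disc R D w -> exists2 x, reduced_form D x & form_root R D x = w.
Proof.
move=> [[_ w_gt1 [w' [w'w [p [irrp pw pw']]] /andP[w'_gt w'_lt0]]]].
move=> [a [b [c [a_gt0 cop eqw eqD]]]].
have aQ_neq0 : a%:~R != 0 :> rat by rewrite intr_eq0 gt_eqF.
pose q : {poly rat} := Poly [:: c%:~R; b%:~R; a%:~R].
have qE x : (map_poly (ratr : rat -> R) q).[x] =
    a%:~R * x ^+ 2 + b%:~R * x + c%:~R.
  have [_ ->] := horner_map_quadratic (ratr : {rmorphism rat -> R}) b%:~R c%:~R x aQ_neq0.
  by rewrite /= !ratr_int.
have pq : p %| q.
  have [//|] := boolP (p %| q); rewrite -irreducible_poly_coprime // => cpq.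
  have := cpq; rewrite -(coprimep_map (ratr : {rmorphism rat -> R})) => /coprimep_root.
  by move=> /(_ _ pw); rewrite qE eqw eqxx.
have eqw' : a%:~R * w' ^+ 2 + b%:~R * w' + c%:~R = 0.
  have /dvdpP[k defq] : map_poly (ratr : rat -> R) p %| map_poly ratr q.
    by rewrite dvdp_map.
  by rewrite -qE defq hornerM (rootP pw') mulr0.
have aR_gt0 : 0 < a%:~R :> R by rewrite ltr0z.
have sumww' : b%:~R = - a%:~R * (w + w').
  by apply: (@mulIf _ (w' - w)); [rewrite subr_eq0 | nra].
have prodww' : c%:~R = a%:~R * (w * w') by move: eqw; rewrite sumww'; nra.
have Dsqr : D%:R = (a%:~R * (w - w')) ^+ 2 :> R.
  rewrite -[LHS]/((D : int)%:~R) eqD.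
  by rewrite expr2 intrB !intrM sumww' prodww'; ring.
exists (a, - b, - c).
  (* These products are the form's [c], [b + c - a] and [b + a - c], written in terms of the
     roots. *)
  have k0 : 0 < a%:~R * (w * - w') by rewrite !mulr_gt0 //; lra.
  have k1 : 0 < a%:~R * ((w - 1) * (1 - w')) by rewrite !mulr_gt0 //; lra.
  have k2 : 0 < a%:~R * ((1 + w) * (1 + w')) by rewrite !mulr_gt0 //; lra.
  have c0 : 0 < - c by rewrite -(ltr_int R) intrN prodww'; lra.
  have h1 : a < - b + - c.
    by rewrite -(ltr_int R) intrD !intrN sumww' prodww'; lra.
  have h2 : - c < - b + a.
    by rewrite -(ltr_int R) intrD !intrN sumww' prodww'; lra.
  rewrite /reduced_form a_gt0 c0 h1 h2 !gcdzN cop eqxx andbT /= eqD.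
  by apply/eqP; ring.
rewrite /form_root /= Dsqr sqrtr_sqr ger0_norm; last by nra.
by rewrite intrN sumww'; field; rewrite gt_eqF.
Qed.

Lemma kappa_reduced_form (R : realType) (D : nat) :
  (forall z x : int, D%:Z * x ^+ 2 = z ^+ 2 -> x = 0) ->
  exists2 F : {fset int * int * int},
    forall x, (x \in F) = reduced_form D x & kappa R D = #|` F|.
Proof.
move=> Dsq; pose A : set (int * int * int) := [set x | reduced_form D x]%classic.
have imA : reduced_of_disc R D = (form_root R D @` A)%classic.
  apply/seteqP; split => [w /reduced_form_root[x ? <-]|_ [x Ax <-]].
    by exists x.
  exact: form_root_reduced.
have injA : {in A &, injective (form_root R D)}.
  by move=> x y; rewrite !inE; apply: form_root_inj.
have finA : finite_set A.
  by rewrite -(eq_finite_set (inj_card_eq injA)) -imA; apply: finite_reduced_of_disc.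
exists (fset_set A).
  move=> x; rewrite in_fset_set //.
  by apply/idP/idP => [/set_mem|h]; last exact/mem_set.
rewrite /kappa imA fset_set_image // card_in_imfset // => x y.
by rewrite !in_fset_set //; apply: injA.
Qed.

(** * The involution that fixes the first coefficient *)

(** The right side says [b < s], [s < b + 2 a] and [2 a - b < s] for the real square root [s] of
    [D]. As [s] lies strictly between [r] and [r + 1], an integer is below [s] iff it is at most
    [r]. *)
Lemma reduced_form_sqrt (D r a b c : int) :
  0 <= r -> r ^+ 2 < D < (r + 1) ^+ 2 -> 0 < a -> b ^+ 2 + 4 * a * c = D ->
  [&& 0 < c, a < b + c & c < b + a] = [&& b <= r, r < b + 2 * a & 2 * a <= b + r].
Proof.
move=> r0 /andP[rD Dr] a0 eqD; apply/idP/idP => [/and3P[c0 h1 h2]|/and3P[h1 h2 h3]].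
  by apply/and3P; split; nia.
have c0 : 0 < c by nia.
apply/and3P; split => //; nia.
Qed.

(* [flip r (a, b, c)] is the form of [n - w'], where w is the root of (a, b, c),
   w' its conjugate, and n the integral part of w; here r = floor (sqrt D). *)
Definition flip (r : int) (x : int * int * int) : int * int * int :=
  let: (a, b, c) := x in
  let n := ((b + r) %/ (2 * a))%Z in
  (a, 2 * a * n - b, c + b * n - a * n ^+ 2).

(** The substitution of [n - X] for [X] preserves discriminant and content. The new root [n - w']
    exceeds 1, its conjugate [n - w] lies in []-1, 0[], and its integral part is again [n]. *)
Lemma flip_reduced (D r : int) (x : int * int * int) :
  0 <= r -> r ^+ 2 < D < (r + 1) ^+ 2 ->
  reduced_form D x -> reduced_form D (flip r x) /\ flip r (flip r x) = x.
Proof.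
case: x => [[a b] c] r0 rD /and5P[a0 c0 ab cb /andP[/eqP eqD /gcdz3_eq1P cop]].
have /esym := reduced_form_sqrt r0 rD a0 eqD; rewrite c0 ab cb /=.
move=> /and3P[h1 h2 h3]; rewrite /flip /reduced_form.
set n := ((b + r) %/ (2 * a))%Z.
have nr : 2 * a * n <= b + r < 2 * a * n + 2 * a by rewrite /n; lia.
have n1 : 1 <= n by nia.
have -> : ((2 * a * n - b + r) %/ (2 * a))%Z = n by apply: divz_bounds; lia.
split; last by congr (_, _, _); ring.
have eqD' : (2 * a * n - b) ^+ 2 + 4 * a * (c + b * n - a * n ^+ 2) = D.
  by rewrite -eqD; ring.
have := reduced_form_sqrt r0 rD a0 eqD'.
have -> : [&& 2 * a * n - b <= r, r < 2 * a * n - b + 2 * a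
  & 2 * a <= 2 * a * n - b + r] by apply/and3P; split; nia.
move=> /and3P[c0' ab' cb'].
rewrite a0 c0' ab' cb' eqD' eqxx /=.
apply/gcdz3_eq1P => d da db dc.
have {}db : (d %| b)%Z.
  have -> : b = 2 * n * a - (2 * a * n - b) by ring.
  by rewrite rpredB // dvdz_mull.
apply: cop => //.
have -> : c = (c + b * n - a * n ^+ 2) - n * b + n ^+ 2 * a by ring.
by apply: rpredD; [apply: rpredB => //; apply: dvdz_mull | apply: dvdz_mull].
Qed.

(** * The exchange of outer coefficients and the genera modulo 3 *)

(** On roots this is the map from [w] to [-1 / w']. *)
Definition swap (x : int * int * int) : int * int * int :=
  let: (a, b, c) := x in (c, b, a).

Lemma swap_reduced (D : int) (x : int * int * int) :
  reduced_form D (swap x) = reduced_form D x.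
Proof.
case: x => [[a b] c]; rewrite /reduced_form /=.
have -> : gcdz (gcdz c b) a = gcdz (gcdz a b) c.
  by rewrite [gcdz c b]gcdzC gcdzC gcdzA.
by rewrite [4 * c * a]mulrAC; apply/and5P/and5P => -[? ? ? ? ?]; split.
Qed.

Lemma swapK : involutive swap.
Proof. by case=> [[a b] c]. Qed.

(* The genus in which the values coprime to 3 are 1 mod 3: a is the value at
   (1, 0), and - c the value at (0, 1), used when 3 divides a. *)
Definition positive_genus (x : int * int * int) : bool :=
  let: (a, b, c) := x in
  (a %% 3 == 1)%Z || ((a %% 3 == 0)%Z && (c %% 3 == 2)%Z).

(** Modulo 3, [b ^ 2 = - a c]: either 3 divides [b] and, by primitivity, exactly one of [a], [c], or
    [a c = -1]. *)
Lemma reduced_form_mod3 (D a b c : int) : (3 %| D)%Z ->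
  reduced_form D (a, b, c) -> 
  [|| [&& a %% 3 == 0, b %% 3 == 0 & c %% 3 != 0]%Z,
      [&& c %% 3 == 0, b %% 3 == 0 & a %% 3 != 0]%Z,
      (a %% 3 == 1)%Z && (c %% 3 == 2)%Z |
      (a %% 3 == 2)%Z && (c %% 3 == 1)%Z].
Proof.
move=> D3 /and5P[_ _ _ _ /andP[/eqP eqD /gcdz3_eq1P cop]].
have h : ~~ [&& (3 %| a)%Z, (3 %| b)%Z & (3 %| c)%Z].
  by apply/negP => /and3P[da db dc]; have := cop 3 da db dc.
move: h D3 eqD; rewrite (divz_eq a 3) (divz_eq b 3) (divz_eq c 3).
have mod3 x : (x %% 3 = 0 \/ x %% 3 = 1 \/ x %% 3 = 2)%Z by lia.
by case: (mod3 a) => [->|[->|->]]; case: (mod3 b) => [->|[->|->]];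
  case: (mod3 c) => [->|[->|->]]; lia.
Qed.

(** Up to a change of variables, [swap] negates the form, hence its values. *)
Lemma positive_genus_swap (D : int) (x : int * int * int) : (3 %| D)%Z ->
  reduced_form D x -> positive_genus (swap x) = ~~ positive_genus x.
Proof.
by case: x => [[a b] c] D3 /(reduced_form_mod3 D3); rewrite /positive_genus /=; lia.
Qed.

Lemma positive_genus_flip (D r : int) (x : int * int * int) : (3 %| D)%Z ->
  reduced_form D x -> positive_genus (flip r x) = positive_genus x.
Proof.
case: x => [[a b] c] D3 /(reduced_form_mod3 D3); rewrite /positive_genus /=.
set n := ((b + r) %/ (2 * a))%Z => h.
have [a3|] := eqVneq (a %% 3)%Z 0; last by lia.
have [a' ->] : exists a', a = 3 * a' by exists (a %/ 3)%Z; lia.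
(* When 3 divides [a] it divides [b] too, so [flip] keeps [c] modulo 3. *)
have [b' ->] : exists b', b = 3 * b' by exists (b %/ 3)%Z; lia.
lia.
Qed.

(** * Forms fixed by the involution *)

(* For odd a, the only candidate for a reduced form fixed by [flip r] with
   first coefficient a: b is the odd multiple of a in ]r - 2 a, r]. *)
Definition ambiguous (D r a : int) : int * int * int :=
  let b := a * (2 * ((r + a) %/ (2 * a))%Z - 1) in
  (a, b, ((D - b ^+ 2) %/ (4 * a))%Z).

Lemma flip_fixed (D r a b c : int) :
  0 <= r -> r ^+ 2 < D < (r + 1) ^+ 2 -> (D %% 4 = 1)%Z ->
  reduced_form D (a, b, c) -> flip r (a, b, c) = (a, b, c) ->
  (a, b, c) = ambiguous D r a /\ exists2 n, 1 <= n & b = a * n.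
Proof.
move=> r0 rD D4 /and5P[a0 c0 ab cb /andP[/eqP eqD _]].
have /esym := reduced_form_sqrt r0 rD a0 eqD; rewrite c0 ab cb /=.
move=> /and3P[h1 h2 h3]; rewrite /flip; set n := ((b + r) %/ (2 * a))%Z.
have nr : 2 * a * n <= b + r < 2 * a * n + 2 * a by rewrite /n; lia.
move=> [eqb _]; have {}eqb : b = a * n by lia.
have n1 : 1 <= n by nia.
split; last by exists n.
(* An even [n] would make [D = b ^ 2 + 4 a c] divisible by 4. *)
have n_odd : (n %% 2 = 1)%Z.
  have [//|n_even] : ((n %% 2 = 1) \/ (n %% 2 = 0))%Z by lia.
  have [m nE] : exists m, n = 2 * m by exists (n %/ 2)%Z; lia.
  by move: D4; rewrite -eqD eqb nE; lia.
have [k nE] : exists k, n = 2 * k - 1 by exists ((n + 1) %/ 2)%Z; lia.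
rewrite /ambiguous; have -> : ((r + a) %/ (2 * a))%Z = k by apply: divz_bounds; lia.
rewrite -nE -eqb; congr (_, _, _).
have -> : D - b ^+ 2 = c * (4 * a) by rewrite -eqD; ring.
by rewrite mulzK // mulf_neq0 ?gt_eqF.
Qed.

(** Dividing the discriminant equation by [a] leaves [a m ^ 2 + 4 c = e], solvable because [m] is
    odd and [a e = 1] mod 4 gives [a = e] mod 4. Coprimality of [a] and [e] makes the form
    primitive. *)
Lemma ambiguous_spec (r a e : int) : let D := a * e in
  0 < a <= r -> r ^+ 2 < D < (r + 1) ^+ 2 -> (D %% 4 = 1)%Z -> coprimez a e ->
  exists m c : int, [/\ ambiguous D r a = (a, a * m, c), a * m ^+ 2 + 4 * c = e,
    reduced_form D (ambiguous D r a) &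
    flip r (ambiguous D r a) = ambiguous D r a].
Proof.
move=> D /andP[a0 ar] rD D4 cop.
have [k kE kr] : exists2 k, ((r + a) %/ (2 * a))%Z = k &
    2 * a * k <= r + a < 2 * a * k + 2 * a by eexists; [reflexivity | lia].
pose m := 2 * k - 1.
have ak : a <= a * k.
  rewrite ler_peMr ?(ltW a0) // -gtz0_ge1 ltNge; apply/negP => k0.
  by have := mulr_ge0_le0 (ltW a0) k0; clear -a0 ar kr; lia.
have [c eqe] : exists c, a * m ^+ 2 + 4 * c = e.
  exists ((e - a * m ^+ 2) %/ 4)%Z; rewrite /m.
  suff : ((e - a) %% 4 = 0)%Z by clear; lia.
  have mod4 x : (x %% 4 = 0 \/ x %% 4 = 1 \/ x %% 4 = 2 \/ x %% 4 = 3)%Z by lia.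
  move: D4; rewrite /D (divz_eq a 4) (divz_eq e 4); clear -mod4.
  by case: (mod4 a) => [->|[->|[->|->]]]; case: (mod4 e) => [->|[->|[->|->]]]; lia.
have eqD : (a * m) ^+ 2 + 4 * a * c = D by rewrite /D -eqe; ring.
have ambE : ambiguous D r a = (a, a * m, c).
  rewrite /ambiguous kE -/m; congr (_, _, _).
  have -> : D - (a * m) ^+ 2 = c * (4 * a) by rewrite -eqD; ring.
  by rewrite mulzK // mulf_neq0 ?gt_eqF.
exists m, c; rewrite !ambE; split => //.
  have := reduced_form_sqrt (le_trans (ltW a0) ar) rD a0 eqD.
  have -> : [&& a * m <= r, r < a * m + 2 * a & 2 * a <= a * m + r].
    by clear -a0 ar kr ak; rewrite /m; apply/and3P; split; lia.
  move=> /and3P[c0 ac ca]; rewrite /reduced_form a0 c0 ac ca eqD eqxx /=.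
  apply/gcdz3_eq1P => d da _ dc.
  have := dvdz_gcd d a e; rewrite (eqP cop) da => ->; rewrite -eqe.
  by apply: rpredD; [apply: dvdz_mulr | apply: dvdz_mull].
have nE : ((a * m + r) %/ (2 * a))%Z = m by apply: divz_bounds; rewrite /m; clear -a0 ar kr ak; lia.
by rewrite /flip nE; congr (_, _, _); ring.
Qed.

Lemma flip_fixed_fst (p : nat) (r a b c : int) :
  prime p -> p = 1 %[mod 4] ->
  0 <= r -> r ^+ 2 < (9 * p)%N%:Z < (r + 1) ^+ 2 ->
  reduced_form (9 * p)%N (a, b, c) -> flip r (a, b, c) = (a, b, c) ->
  [\/ a = 1, a = 9 | a = 5 /\ p = 5].
Proof.
move=> pp p4 r0 rD red flipE.
have D4 : (((9 * p)%N%:Z) %% 4 = 1)%Z by lia.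
have [_ [n n1 bE]] := flip_fixed r0 rD D4 red flipE.
have D3 : (3 %| (9 * p)%N%:Z)%Z by lia.
have mod3 := reduced_form_mod3 D3 red.
have /and5P[a0 c0 _ _ /andP[/eqP eqD _]] := red.
have aD : a * (a * n ^+ 2 + 4 * c) = 9 * p%:Z.
  by rewrite -[RHS](PoszM 9) -eqD bE; ring.
have a_le : a <= a * n ^+ 2 by rewrite ler_peMr ?exprn_ege1 // ltW.
have [/dvdzP[k aE]|pa] := boolP (p%:Z %| a)%Z.
  have p0 : 0 < p%:Z by have := prime_gt0 pp; clear; lia.
  have k0 : 0 < k by rewrite -(pmulr_lgt0 _ p0) -aE.
  (* With [c] positive this bounds [a], hence [p], below 9, leaving only [p = 5]. *)
  have eq9 : k * (a * n ^+ 2 + 4 * c) = 9.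
    by apply: (@mulfI _ p%:Z); [rewrite gt_eqF | rewrite [RHS]mulrC -aD aE; ring].
  have a9 : a < 9.
    have : a * n ^+ 2 + 4 * c <= 9.
      by rewrite -eq9 ler_peMl // addr_ge0 ?mulr_ge0 ?sqr_ge0 ?ltW.
    by clear -a_le c0; lia.
  have p_le : p%:Z <= a by rewrite aE ler_peMl // ltW.
  have p5 : p = 5.
    have p9 : (p < 9)%N by clear -a9 p_le; lia.
    by clear -pp p4 p9; move: pp p4 p9; do 9?[case: p => [|p] //].
  apply: Or33; split => //; move: a9; rewrite aE p5; clear -k0; lia.
have a9 : (a %| 9)%Z.
  rewrite -(@Gauss_dvdzl _ _ p%:Z).
    by apply/dvdzP; exists (a * n ^+ 2 + 4 * c); rewrite -aD mulrC.
  by rewrite /coprimez gcdzC /gcdz; move: pa; rewrite dvdzE -prime_coprime.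
have : `|a|%N \in divisors 9 by rewrite -dvdn_divisors.
rewrite !inE => a139; have {a139} : [|| a == 1, a == 3 | a == 9].
  by clear -a0 a139; lia.
case/or3P => /eqP E; [by apply: Or31 | | by apply: Or32].
(* For [a = 3] all three coefficients would be divisible by 3. *)
by exfalso; move: mod3 eqD; rewrite bE E; clear; lia.
Qed.

(** * The count for discriminant [9 p] *)

Lemma kappa_nine_prime (R : realType) (p : nat) :
  prime p -> p = 1 %[mod 4] ->
  exists2 g, kappa R (9 * p)%N = (2 * g)%N &
    odd g = (p != 2 %[mod 3]) || (p == 5).
Proof.
move=> pp p4.
have Dsq (z x : int) : (9 * p)%N%:Z * x ^+ 2 = z ^+ 2 -> x = 0.
  rewrite PoszM => eqz; have /eqP : 3 * x = 0; last by rewrite mulf_eq0 => /orP[//|/eqP].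
  by apply: (nonsquare_mul_prime (z := z) pp); rewrite -eqz; ring.
have [F FE ->] := kappa_reduced_form R Dsq.
have [r' rD'] := isqrt_exists (9 * p).
pose r : int := r'%:Z.
have r0 : 0 <= r by [].
have rD : r ^+ 2 < (9 * p)%N%:Z < (r + 1) ^+ 2.
  have rD_neq : r ^+ 2 != (9 * p)%N%:Z.
    apply/eqP => eqr; suff : (1 : int) = 0 by [].
    by apply: (Dsq r); rewrite expr1n mulr1.
  by move: rD' rD_neq; rewrite /r; clear; lia.
clearbody r; clear r' rD'.
have D4 : ((9 * p)%N%:Z %% 4 = 1)%Z by clear -p4; lia.
have D3 : (3 %| (9 * p)%N%:Z)%Z by clear; lia.
have cardF : #|` F| = (2 * #|` [fset x in F | positive_genus x]%fset|)%N.
  apply: card_involution_halves swapK _ _ => x; rewrite !FE => red.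
    by rewrite swap_reduced.
  exact: positive_genus_swap D3 red.
set G := [fset x in F | _]%fset in cardF.
have GE x : (x \in G) = reduced_form (9 * p)%N x && positive_genus x.
  by rewrite !inE /= FE.
have flipG : {in G, forall x, flip r x \in G}.
  move=> x; rewrite !GE => /andP[red gen].
  by rewrite (positive_genus_flip r D3 red) gen; case: (flip_reduced r0 rD red) => ->.
have flipK : {in G, cancel (flip r) (flip r)}.
  by move=> x; rewrite GE => /andP[red _]; case: (flip_reduced r0 rD red).
have := odd_card_involution flipG flipK.
set H := [fset x in G | _]%fset => oddG.
have HE x : (x \in H) = [&& reduced_form (9 * p)%N x, positive_genus x & flip r x == x].
  by rewrite !inE /= FE andbA.
pose x1 := ambiguous (9 * p)%N r 1; pose x9 := ambiguous (9 * p)%N r 9.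
have x1H : x1 \in H.
  have r1 : 0 < (1 : int) <= r.
    rewrite /= -gtz0_ge1 lt_neqAle r0 andbT; apply/eqP => r_0; move: rD (prime_gt1 pp).
    by rewrite -r_0; clear; lia.
  have := @ambiguous_spec r 1 (9 * p)%N%:Z r1; rewrite mul1r -/x1.
  case/(_ rD D4 (coprime1n _)) => m [c [ambE _ red flipE]].
  by rewrite HE red flipE eqxx ambE.
have x9H : p = 2 %[mod 3] -> p <> 5 -> x9 \in H.
  move=> p3 p5; have r9 : 0 < (9 : int) <= r.
    (* The only prime below 9 that is 1 mod 4 is 5. *)
    have : (9 <= p)%N by clear -pp p4 p3 p5; move: pp p4 p3 p5; do 9?[case: p => [|p] //].
    by move: rD => /andP[_]; clear -r0; nia.
  have := @ambiguous_spec r 9 p%:Z r9; rewrite -(PoszM 9) -/x9.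
  have cop : coprimez 9 p%:Z.
    rewrite coprimezE -[coprime _ _]/(coprime (3 ^ 2) p) coprimeXl // prime_coprime //.
    by clear -p3; lia.
  case/(_ rD D4 cop) => m [c [ambE eqp red flipE]].
  (* From [9 m ^ 2 + 4 c = p] follows [c = p = 2] mod 3. *)
  rewrite HE red flipE eqxx ambE /=; clear -eqp p3; lia.
have Hx x : x \in H -> x = x1 \/ [/\ x = x9, p = 2 %[mod 3] & p <> 5].
  case: x => [[a b] c]; rewrite HE => /and3P[red gen /eqP flipE].
  have [-> [n n1 bE]] := flip_fixed r0 rD D4 red flipE.
  have /and5P[_ c0 _ _ /andP[/eqP eqD _]] := red.
  have [aE|aE|[aE _]] := flip_fixed_fst pp p4 r0 rD red flipE.
  - by left; rewrite aE.
  - right; rewrite aE; have eqp : p%:Z = 9 * n ^+ 2 + 4 * c.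
      by move: eqD; rewrite bE aE; clear; lia.
    move: gen; rewrite /positive_genus aE /= => c3.
    split => //; first by clear -eqp c3; lia.
    (* Here [p = 9 n ^ 2 + 4 c] is at least 13. *)
    have : 1 <= n ^+ 2 by rewrite exprn_ege1.
    by clear -eqp c0; lia.
  (* As 5 is 2 mod 3, this form lies in the other genus. *)
  - by move: gen; rewrite aE.
have oddE : odd #|` G| = (p != 2 %[mod 3]) || (p == 5).
  rewrite oddG; have [/andP[/eqP p3 /eqP p5]|pN] := boolP ((p == 2 %[mod 3]) && (p != 5)).
    have -> : H = [fset x1; x9]%fset.
      apply/fsetP => x; rewrite in_fset2; apply/idP/orP => [/Hx[->|[-> _ _]]|[/eqP->|/eqP->]].
      - by left.
      - by right.
      - exact: x1H.
      - exact: x9H.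
    have -> : #|` [fset x1; x9]%fset| = 2.
      by rewrite cardfs2; case: eqP => // /(congr1 (fun x => x.1.1)).
    by rewrite p3 eqxx (introF eqP p5).
  have -> : H = [fset x1]%fset.
    apply/fsetP => x; rewrite in_fset1; apply/idP/eqP => [/Hx[//|[_ p3 p5]]|-> //].
    by case/negP: pN; apply/andP; split; apply/eqP.
  by rewrite cardfs1; move: pN; rewrite negb_and negbK => ->.
by exists #|` G|.
Qed.

Local Close Scope ring_scope.

Theorem theorem3p8 (R : realType) (p : nat) :
  prime p -> p = 1 %[mod 4] ->
  (p = 5 \/ p = 1 %[mod 3] -> kappa R (9 * p) = 2 %[mod 4]) /\
  (p = 2 %[mod 3] /\ p <> 5 -> kappa R (9 * p) = 0 %[mod 4]).
Proof.
move=> pp p4; have [g -> oddg] := kappa_nine_prime R pp p4.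
split=> [p_eq|[p3 p5]].
  have {oddg} : odd g by rewrite oddg; clear -p_eq; lia.
  by clear; lia.
have {oddg} : ~~ odd g by rewrite oddg p3 eqxx (introF eqP p5).
by clear; lia.
Qed.
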